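(* Let $A_1,\dots,A_m\subset\mathbb{F}_q$ be non-empty subsets with $|A_i|=d_i$ and $d_1\le\dots\le d_m$, write $A_i=\{\gamma_{i,1},\dots,\gamma_{i,d_i}\}$, let $\mathcal{A}=A_1\times\cdots\times A_m$ with $n=|\mathcal{A}|$ and enumeration $P_1,\dots,P_n$, and let $d$ be a positive integer with $d\le k:=\sum_{i=1}^m(d_i-1)$. Then $$AC_q(d,\mathcal{A})^\perp=\{(w_1c_1,\dots,w_nc_n):(c_1,\dots,c_n)\in AC_q(k-d-1,\mathcal{A})\},$$ where $w_j^{-1}=\prod_{i=1}^m g_i'(P_j)$ for $j=1,\dots,n$.
   Context: $\mathbb{F}_q$ is the finite field with $q$ elements. For an integer $e\le k$, $S_{\le e}(\mathcal{A})$ is the $\mathbb{F}_q$-vector space of polynomials $f\in\mathbb{F}_q[x_1,\dots,x_m]$ of total degree at most $e$ with $\deg_{x_i}f<d_i$ for all $i$ (it is $\{0\}$ if $e<0$). The affine cartesian code is $AC_q(e,\mathcal{A})=\{(f(P_1),\dots,f(P_n)):f\in S_{\le e}(\mathcal{A})\}\subseteq\mathbb{F}_q^n$. For a linear code $C\subseteq\mathbb{F}_q^N$, the dual code is $C^\perp=\{(e_1,\dots,e_N)\in\mathbb{F}_q^N:c_1e_1+\cdots+c_Ne_N=0\text{ for all }(c_1,\dots,c_N)\in C\}$. The polynomials $g_i$ are $g_i=\prod_{j=1}^{d_i}(x_i-\gamma_{i,j})$, $g_i'$ is the (partial) derivative of $g_i$ with respect to $x_i$, and $g_i'(P_j)$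 is its value at the point $P_j$ (i.e. at the $i$-th coordinate of $P_j$). *)

(* Defs.v *)
From HB Require Import structures.
From mathcomp Require Import all_boot all_order all_algebra.
From mathcomp Require Import mpoly.
From mathcomp Require Import boolp classical_sets.

Set Implicit Arguments.
Unset Strict Implicit.
Unset Printing Implicit Defensive.

Import GRing.Theory.
Local Open Scope ring_scope.
Local Open Scope classical_set_scope.

(* The degree bounds are required of every monomial in the support, so the
   zero polynomial satisfies them all and is the only member when e < 0. *)
Definition cart_polys (F : finFieldType) (m : nat) (A : 'I_m -> {set F})
    (e : int) : set {mpoly F[m]} :=
  [set f | forall u : 'X_{1..m}, u \in msupp f ->
     (mdeg u)%:Z <= e /\ forall i : 'I_m, (u i < #|A i|)%N].

(* P enumerates the points of the cartesian set; this is not enforced here. *)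
Definition cart_code (F : finFieldType) (m n : nat) (A : 'I_m -> {set F})
    (P : 'I_n -> {ffun 'I_m -> F}) (e : int) : set 'rV[F]_n :=
  [set \row_(j < n) f.@[P j] | f in cart_polys A e].

Definition dual_code (F : finFieldType) (n : nat) (C : set 'rV[F]_n)
    : set 'rV[F]_n :=
  [set v | forall c : 'rV[F]_n, C c -> \sum_(i < n) c 0 i * v 0 i = 0].

Definition vanishing_poly (F : finFieldType) (m : nat) (A : 'I_m -> {set F})
    (i : 'I_m) : {mpoly F[m]} :=
  \prod_(a in A i) ('X_i - a%:MP).

(* Main.v *)
Require Import Defs.
From mathcomp Require Import all_boot all_order all_algebra.
From mathcomp Require Import mpoly.
From mathcomp Require Import boolp classical_sets.

Set Implicit Arguments.
Unset Strict Implicit.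
Unset Printing Implicit Defensive.

Import GRing.Theory.
Local Open Scope ring_scope.
Local Open Scope classical_set_scope.

(** The weights w_j are those of multivariate Lagrange interpolation, and they
    make weighted summation over the grid a residue functional.  In one
    variable, comparing the coefficients of degree |B| - 1 in the Lagrange
    expansion of X^t on a set B shows that the sum over a in B of
    a^t / g'(a), where g is the monic polynomial with root set B, is 0 for
    t < |B| - 1 and 1 for t = |B| - 1 ([lagrange_moment]).  The value of
    w at a grid point is a product of one-variable factors, so the weighted
    sum of a monomial over the grid is a product of such moments.  A monomial
    of total degree at most k either has some exponent i below d_i - 1, and one
    factor vanishes, or is the monomial x^top with exponents d_i - 1.  Hence,
    for every polynomial g of degree at most k, the sum of w_j g(P_j) is the
    coefficient of x^top in g ([weighted_grid_sum]).

    Both inclusions follow by applying this to a product f h.  If deg f <= d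
    and deg h <= k - d - 1, then f h has degree below k, so x^top does not occur
    in it and the pairing vanishes.  Conversely, given v in the dual code,
    interpolate v_j / w_j by a polynomial h with deg_(x_i) h < d_i for all i
    ([grid_interpolation]).  If h had degree at least k - d, its leading
    monomial x^u would satisfy u <= top, and f := x^(top - u) would have degree
    at most d; then f h has degree at most k, and its coefficient at x^top is
    the leading coefficient of h.  Orthogonality forces that coefficient to be
    0, which is absurd.  *)

(** The value of this polynomial at a point a of B is the derivative at a of the
    monic polynomial with root set B, that is, the denominator of the Lagrange
    basis polynomial. *)
Definition other_nodes_poly (F : finFieldType) (B : {set F}) (a : F)
    : {poly F} :=
  \prod_(b in (B :\ a)%SET) ('X - b%:P).

Lemma monic_other_nodes_poly (F : finFieldType) (B : {set F}) (a : F) :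
  other_nodes_poly B a \is monic.
Proof. by apply: rpred_prod => b _; rewrite monicXsubC. Qed.

Lemma size_other_nodes_poly (F : finFieldType) (B : {set F}) (a : F) :
  a \in B -> size (other_nodes_poly B a) = #|B|.
Proof.
move=> aB; rewrite /other_nodes_poly -big_enum /= size_prod_XsubC.
by rewrite -cardE [RHS](cardsD1 a) aB.
Qed.

Lemma horner_other_nodes_poly (F : finFieldType) (B : {set F}) (a x : F) :
  (other_nodes_poly B a).[x] = \prod_(b in (B :\ a)%SET) (x - b).
Proof. by rewrite horner_prod; apply: eq_bigr => b _; rewrite !hornerE. Qed.

Lemma other_nodes_poly_neq0 (F : finFieldType) (B : {set F}) (a : F) :
  (other_nodes_poly B a).[a] != 0.
Proof.
rewrite horner_other_nodes_poly; apply/prodf_neq0 => b /setD1P[ba _].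
by rewrite subr_eq0 eq_sym.
Qed.

Definition lagrange_poly (F : finFieldType) (B : {set F}) (a : F) : {poly F} :=
  (other_nodes_poly B a).[a]^-1 *: other_nodes_poly B a.

Lemma size_lagrange_poly (F : finFieldType) (B : {set F}) (a : F) :
  a \in B -> size (lagrange_poly B a) = #|B|.
Proof.
move=> aB; rewrite size_scale ?size_other_nodes_poly //.
by rewrite invr_neq0 ?other_nodes_poly_neq0.
Qed.

Lemma horner_lagrange_poly (F : finFieldType) (B : {set F}) (a x : F) :
  x \in B -> (lagrange_poly B a).[x] = (x == a)%:R.
Proof.
move=> xB; rewrite /lagrange_poly hornerZ.
have [->|xa] := eqVneq x a; first by rewrite mulVf ?other_nodes_poly_neq0.
rewrite (horner_other_nodes_poly B a x) (bigD1 x) ?in_setD1 ?xa //=.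
by rewrite subrr mul0r mulr0.
Qed.

(** Interpolating X^t on B is exact because t < |B|; the sum is the coefficient
    of degree |B| - 1 of the interpolant, since each product over the other
    nodes is monic of that degree. *)
Lemma lagrange_moment (F : finFieldType) (B : {set F}) (t : nat) :
  (t < #|B|)%N ->
  \sum_(a in B) a ^+ t / (other_nodes_poly B a).[a] = (t == #|B|.-1)%:R.
Proof.
move=> ltB.
pose p : {poly F} := 'X^t - \sum_(a in B) a ^+ t *: lagrange_poly B a.
have p0 : p = 0.
  apply: (@roots_geq_poly_eq0 _ p (enum B)); last first.
  - rewrite -cardE (leq_trans (size_polyD _ _)) // geq_max size_polyXn ltB.
    rewrite size_polyN (leq_trans (size_sum _ _ _)) //.
    apply/bigmax_leqP => a aB.
    by rewrite (leq_trans (size_scale_leq _ _)) ?size_lagrange_poly.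
  - exact: enum_uniq.
  apply/allP => x; rewrite mem_enum => xB; rewrite /root !hornerE horner_sum.
  rewrite (bigD1 x) //= hornerZ horner_lagrange_poly // eqxx mulr1.
  rewrite big1 ?addr0 ?subrr // => a /andP[_ ax].
  by rewrite hornerZ horner_lagrange_poly // eq_sym (negPf ax) mulr0.
have /eqP := congr1 (coefp #|B|.-1) p0.
rewrite /coefp coef0 coefB coefXn coef_sum subr_eq0 eq_sym => /eqP.
rewrite [in RHS]eq_sym => <-; apply: eq_bigr => a aB.
have /monicP := monic_other_nodes_poly B a.
by rewrite lead_coefE size_other_nodes_poly // !coefZ => ->; rewrite mulr1.
Qed.

(** By the product rule, only the term that differentiates the factor vanishing
    at p survives; this identifies the weights of the theorem with Lagrange
    denominators. *)
Lemma mderiv_vanishing_poly (F : finFieldType) (m : nat)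
    (A : 'I_m -> {set F}) (i : 'I_m) (p : 'I_m -> F) :
  p i \in A i ->
  ((vanishing_poly A i)^`M(i)).@[p] = (other_nodes_poly (A i) (p i)).[p i].
Proof.
move=> piA; rewrite /vanishing_poly (big_setD1 (p i)) //= mderivM mderivB.
rewrite mderivC mderivX subr0 mevalD !mevalM mevalB mevalC mevalXU subrr mul0r addr0.
rewrite mnm1E eqxx scale1r -{1}[U_(i)%MM]add0m addmK mpolyX0 meval1 mul1r.
rewrite horner_other_nodes_poly rmorph_prod /=.
by apply: eq_bigr => b _; rewrite mevalB mevalC mevalXU.
Qed.

Definition top_monomial (F : finFieldType) (m : nat) (A : 'I_m -> {set F})
    : 'X_{1..m} :=
  [multinom (#|A i| - 1)%N | i < m].

Lemma mdeg_top_monomial (F : finFieldType) (m : nat) (A : 'I_m -> {set F}) :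
  mdeg (top_monomial A) = (\sum_(i < m) (#|A i| - 1))%N.
Proof. by rewrite mdegE; apply: eq_bigr => i _; rewrite mnmE. Qed.

Lemma mem_grid (F : finFieldType) (m n : nat) (A : 'I_m -> {set F})
    (P : 'I_n -> {ffun 'I_m -> F}) (P_im : [set P j | j : 'I_n]%SET = setXn A)
    (j : 'I_n) (i : 'I_m) :
  P j i \in A i.
Proof.
have : P j \in setXn A by rewrite -P_im; apply/imsetP; exists j.
by move/setXnP.
Qed.

(** Reindexing along the enumeration P turns the left side into a sum over all
    choices of one element in each A i, which is the expanded product. *)
Lemma sum_grid_prod (F : finFieldType) (m n : nat) (A : 'I_m -> {set F})
    (P : 'I_n -> {ffun 'I_m -> F}) (P_inj : injective P)
    (P_im : [set P j | j : 'I_n]%SET = setXn A) (G : 'I_m -> F -> F) :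
  \sum_(j < n) \prod_(i < m) G i (P j i) = \prod_(i < m) \sum_(a in A i) G i a.
Proof.
rewrite (bigA_distr_big_dep (fun i => mem (A i))) /=.
rewrite (eq_bigl (fun f => f \in [set P j | j : 'I_n]%SET)); last first.
  move=> f; rewrite P_im; apply/familyP/setXnP => h i; exact: h.
by rewrite big_imset //=; apply: in2W.
Qed.

(** A product of one-variable Lagrange polynomials, one for each coordinate, is
    the indicator of a grid point.  It is written here already expanded into
    monomials, so that the bounds on the exponents can be read off from the sizes
    of the factors and its values come from distributing the product. *)
Lemma grid_interpolation (F : finFieldType) (m n : nat) (A : 'I_m -> {set F})
    (P : 'I_n -> {ffun 'I_m -> F}) (P_inj : injective P)
    (P_im : [set P j | j : 'I_n]%SET = setXn A) (c : 'I_n -> F) :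
  exists2 h : {mpoly F[m]},
    (forall u, u \in msupp h -> forall i, (u i < #|A i|)%N) &
    forall j, h.@[P j] = c j.
Proof.
pose q i j : {poly F} := lagrange_poly (A i) (P j i).
have sq i j : size (q i j) = #|A i|.
  by rewrite size_lagrange_poly ?(mem_grid P_im).
(* N bounds all the sizes, so that the exponents of every variable range over
   the same finite type; the excess coefficients of q i j are 0. *)
pose N := (\max_i #|A i|)%N.
have leN i : (#|A i| <= N)%N by exact: (leq_bigmax_cond (F := fun i => #|A i|)).
pose h : {mpoly F[m]} := \sum_(j < n) c j *:
  \sum_(f : {ffun 'I_m -> 'I_N})
    (\prod_i (q i j)`_(f i)) *: 'X_[[multinom (f i : nat) | i < m]].
exists h => [u|k].
  rewrite mcoeff_msupp => hu i; rewrite ltnNge; apply: contra hu => leu.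
  rewrite /h raddf_sum big1 //= => j _; rewrite mcoeffZ raddf_sum big1 ?mulr0 //=.
  move=> f _; rewrite mcoeffZ mcoeffX; case: eqP => [fu|]; last by rewrite mulr0.
  rewrite (bigD1 i) //= nth_default ?mul0r //.
  by rewrite sq (leq_trans leu) // -fu mnmE.
have hE j : (\sum_(f : {ffun 'I_m -> 'I_N}) (\prod_i (q i j)`_(f i)) *:
    'X_[[multinom (f i : nat) | i < m]]).@[P k] = (k == j)%:R.
  transitivity (\prod_i (q i j).[P k i]); last first.
    have [->|kj] := eqVneq k j.
      by rewrite big1 // => i _; rewrite horner_lagrange_poly ?eqxx ?(mem_grid P_im).
    have /eqP/ffunP/eqfunP : P k != P j by apply: contra kj => /eqP/P_inj->.
    rewrite negb_forall => /existsP[i ne].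
    rewrite (bigD1 i) //= horner_lagrange_poly ?(mem_grid P_im) //.
    by rewrite (negPf ne) mul0r.
  transitivity (\prod_i \sum_(t < N) (q i j)`_t * P k i ^+ t); last first.
    by apply: eq_bigr => i _; rewrite (horner_coef_wide _ (n := N)) ?sq.
  rewrite bigA_distr_bigA raddf_sum; apply: eq_bigr => f _ /=.
  rewrite mevalZ mevalX big_split /=; congr (_ * _).
  by apply: eq_bigr => i _; rewrite mnmE.
rewrite /h raddf_sum (bigD1 k) //= mevalZ hE eqxx mulr1.
by rewrite big1 ?addr0 // => j /negPf jk; rewrite mevalZ hE eq_sym jk mulr0.
Qed.

(** A monomial of degree at most that of the top one, other than the top one,
    has an exponent smaller than the corresponding top exponent, so its weighted
    sum has a vanishing one-variable moment as a factor. *)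
Lemma weighted_grid_sum (F : finFieldType) (m n : nat) (A : 'I_m -> {set F})
    (A_neq0 : forall i : 'I_m, A i != finset.set0)
    (P : 'I_n -> {ffun 'I_m -> F}) (P_inj : injective P)
    (P_im : [set P j | j : 'I_n]%SET = setXn A)
    (w : 'I_n -> F)
    (w_inv : forall j : 'I_n,
       (w j)^-1 = \prod_(i < m) ((vanishing_poly A i)^`M(i)).@[P j])
    (g : {mpoly F[m]}) :
  (forall u, u \in msupp g -> (mdeg u <= mdeg (top_monomial A))%N) ->
  \sum_(j < n) w j * g.@[P j] = g@_(top_monomial A).
Proof.
move=> gle.
have wE j : w j = \prod_i ((other_nodes_poly (A i) (P j i)).[P j i])^-1.
  rewrite -[w j]invrK w_inv -prodfV; apply: eq_bigr => i _.
  by rewrite mderiv_vanishing_poly ?(mem_grid P_im).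
have monE (u : 'X_{1..m}) : (mdeg u <= mdeg (top_monomial A))%N ->
    \sum_(j < n) w j * ('X_[u]).@[P j] = (u == top_monomial A)%:R.
  move=> leu.
  transitivity
    (\prod_i \sum_(a in A i) a ^+ u i / (other_nodes_poly (A i) a).[a]).
    rewrite -(sum_grid_prod P_inj P_im
      (fun i a => a ^+ u i / (other_nodes_poly (A i) a).[a])).
    by apply: eq_bigr => j _; rewrite wE mevalX mulrC -big_split.
  have [/forallP geu|] := boolP [forall i, (#|A i| - 1 <= u i)%N].
    have -> : u = top_monomial A.
      have le : (top_monomial A <= u)%MM by apply/mnm_lepP => i; rewrite mnmE.
      have /esym := submK le; move: leu; rewrite -{1}(submK le) mdegD.
      rewrite -[leqRHS]add0n leq_add2r leqn0 mdeg_eq0 => /eqP ->.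
      by rewrite add0m.
    rewrite eqxx big1 // => i _; rewrite mnmE lagrange_moment subn1 ?eqxx //.
    by rewrite prednK // card_gt0.
  rewrite negb_forall => /existsP[i]; rewrite -ltnNge => ltu.
  have -> : (u == top_monomial A) = false.
    by apply: contraTF ltu => /eqP ->; rewrite mnmE ltnn.
  rewrite (bigD1 i) //= lagrange_moment ?(leq_trans ltu) ?leq_subr //.
  by rewrite -subn1 (ltn_eqF ltu) mul0r.
rewrite [g in LHS]mpolyE.
under eq_bigr do rewrite raddf_sum mulr_sumr.
rewrite exchange_big /= [g in RHS]mpolyE raddf_sum /= !big_seq.
apply: eq_bigr => u ug; rewrite mcoeffZ mcoeffX -monE ?gle // mulr_sumr.
by apply: eq_bigr => j _; rewrite mevalZ mulrCA.
Qed.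

Theorem theorem5p7 (F : finFieldType) (m n : nat) (A : 'I_m -> {set F})
    (A_neq0 : forall i : 'I_m, A i != finset.set0)
    (A_sorted : forall i j : 'I_m, (i <= j)%N -> (#|A i| <= #|A j|)%N)
    (P : 'I_n -> {ffun 'I_m -> F})
    (P_inj : injective P)
    (P_im : [set P j | j : 'I_n]%SET = setXn A)
    (d : nat) (d_gt0 : (0 < d)%N)
    (d_le : (d <= \sum_(i < m) (#|A i| - 1))%N)
    (w : 'I_n -> F)
    (w_inv : forall j : 'I_n,
       (w j)^-1 = \prod_(i < m) ((vanishing_poly A i)^`M(i)).@[P j]) :
  dual_code (cart_code A P d%:Z) =
  [set \row_(j < n) (w j * c 0 j) | c in
    cart_code A P ((\sum_(i < m) (#|A i| - 1))%N%:Z - d%:Z - 1)].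
Proof.
rewrite -mdeg_top_monomial.
have w_neq0 j : w j != 0.
  rewrite -invr_eq0 w_inv; apply/prodf_neq0 => i _.
  by rewrite mderiv_vanishing_poly ?(mem_grid P_im) ?other_nodes_poly_neq0.
have pairing (f h : {mpoly F[m]}) :
    (forall u, u \in msupp (f * h) -> (mdeg u <= mdeg (top_monomial A))%N) ->
    \sum_(j < n) f.@[P j] * (w j * h.@[P j]) = (f * h)@_(top_monomial A).
  move=> /(weighted_grid_sum A_neq0 P_inj P_im w_inv) <-.
  by apply: eq_bigr => j _; rewrite mevalM mulrCA.
have ltE (e : nat) : (e%:Z <= (mdeg (top_monomial A))%:Z - d%:Z - 1)%R =
    (e + d < mdeg (top_monomial A))%N.
  by rewrite Num.Theory.lerBrDr -PoszD Num.Theory.lerBrDr -PoszD lez_nat addn1 addSn.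
apply/seteqP; split => [v vdual|_ [_ [h hdeg <-] <-] _ [f fdeg <-]]; last first.
  have suppE u : u \in msupp (f * h) -> (mdeg u < mdeg (top_monomial A))%N.
    move/msuppM_le/allpairsP => [[a b] /= [/fdeg[ad _] /hdeg[bd _] ->]].
    by move: ad bd; rewrite ltE lez_nat mdegD => ad; apply: leq_ltn_trans;
       rewrite addnC leq_add2l.
  rewrite (eq_bigr (fun j => f.@[P j] * (w j * h.@[P j]))); last first.
    by move=> j _; rewrite !mxE.
  rewrite pairing => [|u /suppE/ltnW //].
  by apply: memN_msupp_eq0; apply/negP => /suppE; rewrite ltnn.
have [h hred hv] := grid_interpolation P_inj P_im (fun j => v 0 j / w j).
exists (\row_j h.@[P j]); last first.
  by apply/rowP => j; rewrite !mxE hv mulrC divfK.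
exists h => // u uh; split; last exact: hred.
rewrite ltE ltnNge; apply/negP => leu.
have h0 : h != 0 by apply: contraTneq uh => ->; rewrite msupp0.
have lemax b : b \in msupp h -> (mdeg b <= mdeg (mlead h))%N.
  by move=> bh; rewrite -ltnS mlead_deg // msize_mdeg_lt.
have letop : (mlead h <= top_monomial A)%MM.
  apply/mnm_lepP => i; rewrite mnmE leq_subRL.
    by rewrite add1n hred ?mlead_supp.
  by rewrite card_gt0.
(* The complementary monomial moves the leading monomial of h to the top one. *)
pose s := (top_monomial A - mlead h)%MM.
have topE : (mlead h + s)%MM = top_monomial A by rewrite addmC submK.
have sd : (mdeg s <= d)%N.
  rewrite -(leq_add2l (mdeg (mlead h))) -mdegD topE (leq_trans leu) //.
  by rewrite leq_add2r lemax.
have := vdual (\row_j ('X_[s] : {mpoly F[m]}).@[P j]).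
rewrite (eq_bigr (fun j => ('X_[s]).@[P j] * (w j * h.@[P j]))); last first.
  by move=> j _; rewrite !mxE hv [w j * _]mulrC divfK.
rewrite pairing => [|b]; last first.
  rewrite mulrC => /msuppM_le/allpairsP[[a x] /= [/lemax ah]].
  rewrite msuppX inE => /eqP -> ->.
  by rewrite -topE !mdegD leq_add2r.
have -> : ('X_[s] * h)@_(top_monomial A) = h@_(mlead h).
  by rewrite mulrC -[top_monomial A]topE addmC mcoeffMX.
move=> coef0.
have /eqP : h@_(mlead h) = 0.
  apply: coef0; exists 'X_[s] => // x; rewrite msuppX inE => /eqP ->.
  split=> [|i]; first by rewrite lez_nat.
  rewrite !mnmE (leq_ltn_trans (leq_subr _ _)) // subn1 prednK ?card_gt0 //.
by rewrite mleadc_eq0 (negPf h0).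
Qed.
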